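(* Let $\psi\in\Psi_\infty$, $\alpha\in(0,1]$, and let $\mathring{C}$ be the $d$-dimensional outer power Archimedean copula generated by $\mathring\psi(t)=\psi(t^\alpha)$, $t\in[0,\infty)$. Let $\boldsymbol{t}\in(0,1]^d$ be such that $\mathring{C}(\boldsymbol{t})>0$. Then the copula of $\mathring{C}$ right-truncated at $\boldsymbol{t}$ is (tilted outer power) Archimedean with generator $$\tilde\psi(t)=\frac{\mathring\psi\bigl(t+\mathring\psi^{-1}[\mathring{C}(\boldsymbol{t})]\bigr)}{\mathring{C}(\boldsymbol{t})},\quad t\in[0,\infty).$$
   Context: For $\boldsymbol{U}\sim C$ ($C$ a $d$-dimensional copula) and $\boldsymbol{t}\in(0,1]^d$ with $C(\boldsymbol{t})>0$, the copula of $C$ right-truncated at $\boldsymbol{t}$ is the (unique) copula of the conditional distribution of $\boldsymbol{U}$ given $\boldsymbol{U}\le\boldsymbol{t}$ (componentwise). $\Psi_\infty$ is the set of completely monotone Archimedean generators, i.e. continuous functions $\psi:[0,\infty)\to[0,1]$ with $\psi(0)=1$, $\lim_{t\to\infty}\psi(t)=0$ and $(-1)^k\psi^{(k)}(t)\ge0$ for all $t>0$, $k\in\mathbb{N}_0$ (equivalently, Laplace--Stieltjes transforms of distribution functions on the positive real line). These generate Archimedean copulas $C(\boldsymbol{u})=\psi(\psi^{-1}[u_1]+\dots+\psi^{-1}[u_d])$ in every dimension, with $\psi^{-1}[0]=\infty$, $\psi(\infty)=0$. If $\psi\in\Psi_\infty$ and $\alpha\in(0,1]$ then $\mathring\psi(t)=\psi(t^\alpha)$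 is in $\Psi_\infty$, and the copula generated by $\mathring\psi$ is called an outer power Archimedean copula. A tilted generator of a generator $\psi$ is $t\mapsto\psi(t+h)/\psi(h)$ for a tilt $h\ge0$. *)

(* Defs.v *)
(* Built on MathComp-Analysis. *)
From HB Require Import structures.
From mathcomp Require Import all_boot all_order all_algebra.
From mathcomp Require Import all_classical all_reals all_analysis.

Set Implicit Arguments.
Unset Strict Implicit.
Unset Printing Implicit Defensive.

Import Order.TTheory GRing.Theory Num.Theory.
Import numFieldNormedType.Exports.

Local Open Scope classical_set_scope.
Local Open Scope ring_scope.

(* A function on [0, oo) is represented by a total function R -> R whose values
   on negative arguments are irrelevant. *)
Section generators.
Variable R : realType.
Implicit Types (psi : R -> R) (alpha h : R).

(* The class Psi_oo; derivatives of all orders are required to exist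
   on ]0, oo[. *)
Definition cm_generator psi : Prop :=
  [/\ {within `[0, +oo[, continuous psi},
      forall s, 0 <= s -> 0 <= psi s <= 1,
      psi 0 = 1,
      psi s @[s --> +oo] --> 0 &
      forall (k : nat) s, 0 < s ->
        derivable (derive1n k psi) s 1 /\ 0 <= (-1) ^+ k * derive1n k psi s].

Definition outer_power psi alpha : R -> R := fun s => psi (s `^ alpha).

Definition tilted_generator psi h : R -> R := fun s => psi (s + h) / psi h.

(* psi as a function of [0, oo], with psi oo = 0 *)
Definition gen_ext psi (x : \bar R) : R := if x is s%:E then psi s else 0.

(* The inverse [0, 1] -> [0, oo] of psi, with psi^-1[0] = oo. For psi in Psi_oo
   and 0 < u <= 1 the set below is a singleton, so that the infimum merely
   selects its element. *)
Definition gen_inv psi (u : R) : \bar R :=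
  if u == 0 then +oo%E
  else ereal_inf [set s%:E | s in [set s : R | 0 <= s /\ psi s = u]].

Definition archimedean (d : nat) psi (u : 'I_d -> R) : R :=
  gen_ext psi (\sum_(j < d) gen_inv psi (u j))%E.

Definition unit_cube (d : nat) : set ('I_d -> R) :=
  [set u | forall j, 0 <= u j <= 1].

End generators.

Section copulas.
Context {disp : measure_display} {T : measurableType disp} {R : realType}.
Variable d : nat.
Implicit Types (P : probability T R) (x t : 'I_d -> R).

Definition le_event (X : 'I_d -> {mfun T >-> R}) x : set T :=
  \bigcap_(j in [set: 'I_d]) X j @^-1` `]-oo, x j].

Lemma measurable_le_event (X : 'I_d -> {mfun T >-> R}) x :
  measurable (le_event X x).
Proof.
apply: fin_bigcap_measurable; first exact: finite_finset.
by move=> j _; rewrite -[X in measurable X]setTI; exact: measurable_funPT.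
Qed.

Definition joint_cdf P (X : 'I_d -> {RV P >-> R}) x : \bar R :=
  P (le_event X x).

(* U ~ C, where only the values of C on the unit cube matter *)
Definition copula_law P (U : 'I_d -> {RV P >-> R}) (C : ('I_d -> R) -> R) :=
  (forall j A, measurable A ->
     distribution P (U j) A = uniform_prob (@ltr01 R) A) /\
  (forall u, unit_cube u -> joint_cdf U u = (C u)%:E).

End copulas.

Definition is_copula (R : realType) (d : nat) (C : ('I_d -> R) -> R) : Prop :=
  exists (disp : measure_display) (T : measurableType disp)
    (P : probability T R) (U : 'I_d -> {RV P >-> R}), copula_law U C.

Section truncation.
Context {disp : measure_display} {T : measurableType disp} {R : realType}.
Variable d : nat.
Implicit Type P : probability T R.

(* K is a copula of the joint law of X, in the sense of Sklar's theorem *)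
Definition is_copula_of P (X : 'I_d -> {RV P >-> R})
    (K : ('I_d -> R) -> R) : Prop :=
  is_copula K /\
  forall x : 'I_d -> R,
    joint_cdf X x = (K (fun j => fine (cdf (X j) (x j))))%:E.

(* P(. | A) = P(. `&` A) / P(A); it is P if P(A) = 0. *)
Definition cond_prob P (A : set T) (mA : measurable A) : probability T R :=
  mnormalize (mrestr P mA) P.

(* K is a copula of the conditional distribution of U given U <= t. *)
Definition right_truncated_copula P (U : 'I_d -> {RV P >-> R}) (t : 'I_d -> R)
    (K : ('I_d -> R) -> R) : Prop :=
  is_copula_of (P := cond_prob P (measurable_le_event U t)) U K.

End truncation.

(* Main.v *)
Require Import Defs.
From HB Require Import structures.
From mathcomp Require Import all_boot all_order all_algebra.
From mathcomp Require Import all_classical all_reals all_analysis.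
From mathcomp Require Import ring.

Import Order.TTheory GRing.Theory Num.Theory.
Import numFieldNormedType.Exports.

Local Open Scope classical_set_scope.
Local Open Scope ring_scope.

(** Write psi for the outer power generator and t_j = psi b_j. Then
    C(t) = psi h with h = sum_j b_j, and conditioning on U <= t turns the j-th
    margin into

      F_j (psi a) = psi (h + (a - b_j)) / psi h        for a >= b_j,

    because only the j-th summand of h is replaced. So the inverse of the
    tilted generator s |-> psi (s + h) / psi h sends F_j (psi a_j), if it is
    positive, to a_j - b_j. These differences add up to (sum_j a_j) - h, and
    the shift by h in the tilted generator cancels the - h: the tilted
    Archimedean copula evaluated at the margins is psi (sum_j a_j) / psi h = C(y) / C(t), where
    y_j = psi a_j, which is the conditional joint distribution function at y
    ([archimedean_tilted], [right_truncated_archimedean]).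

    The margins F_j take every value in [0, 1], so Sklar's theorem determines
    the copula on the whole cube; conversely, transforming each coordinate by
    its own distribution function yields uniform variables whose joint law is
    that copula ([sklar_continuous]). The same transform therefore shows that
    the tilted Archimedean function is a copula.

    Two facts about generators are needed. Complete monotonicity survives the
    substitution of s `^ alpha, since the derivative of f (s `^ alpha) is the
    product of f' (s `^ alpha), to which induction applies, and of the
    completely monotone function alpha * s `^ (alpha - 1)
    ([alternating_comp_powR], [cm_outer_power]). And a generator is strictly
    decreasing as long as it is positive, so that its inverse is genuine
    ([cm_decr], [gen_invK]): a flat stretch would, by convexity, last forever,
    and the limit 0 at infinity would force its value to be 0 ([cm_flat]). *)

(** * Functions with derivatives of alternating signs *)

Section alternating_upto.
Context {R : realType}.
Implicit Types (f g p : R -> R) (k m : nat).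

(** The signs (-1)^j f^(j) >= 0 on ]0, +oo[ for all j <= k. Each derivative is
    carried by a witness, so that only its values on ]0, +oo[ matter, and
    closure properties can be proved by induction on k without a formula for
    the iterated derivatives. *)
Fixpoint alternating_upto k f : Prop :=
  (forall s, 0 < s -> 0 <= f s) /\
  if k is k'.+1 then
    exists2 g : R -> R, (forall s : R, 0 < s -> is_derive s 1 f (- g s)) &
      alternating_upto k' g
  else True.

Lemma alternating_ge0 k f s : alternating_upto k f -> 0 < s -> 0 <= f s.
Proof. by case: k => [|k] [f0 _]; apply: f0. Qed.

Lemma alternatingW k f : alternating_upto k.+1 f -> alternating_upto k f.
Proof.
elim: k f => [f [f0 _]//|k IH f [f0 [g fg ag]]].
by split => //; exists g => //; exact: IH.
Qed.

Lemma alternatingD k f g :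
  alternating_upto k f -> alternating_upto k g ->
  alternating_upto k (fun s => f s + g s).
Proof.
elim: k f g => [|k IH] f g [f0 af] [g0 ag].
  by split => // s s0; rewrite addr_ge0 ?f0 ?g0.
split => [s s0|]; first by rewrite addr_ge0 ?f0 ?g0.
move: af ag => [f' ff' af'] [g' gg' ag'].
exists (fun s => f' s + g' s); last exact: IH.
move=> s s0; rewrite opprD.
by have ? := ff' _ s0; have ? := gg' _ s0; apply: is_deriveD.
Qed.

(** By the product rule, - (f g)' = f (- g') + g (- f'), a sum of products
    of lower order. *)
Lemma alternatingM k f g :
  alternating_upto k f -> alternating_upto k g ->
  alternating_upto k (fun s => f s * g s).
Proof.
elim: k f g => [|k IH] f g af ag.
  by split => // s s0; rewrite mulr_ge0 ?(alternating_ge0 _ _ _ af)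
    ?(alternating_ge0 _ _ _ ag).
split => [s s0|].
  by rewrite mulr_ge0 ?(alternating_ge0 _ _ _ af) ?(alternating_ge0 _ _ _ ag).
have af1 := alternatingW _ _ af; have ag1 := alternatingW _ _ ag.
move: af ag => [f0 [f' ff' af']] [g0 [g' gg' ag']].
exists (fun s => f s * g' s + g s * f' s); last first.
  by apply: alternatingD; exact: IH.
move=> s s0; have ? := ff' _ s0; have ? := gg' _ s0.
have : is_derive s 1 (fun s => f s * g s) (f s *: (- g' s) + g s *: (- f' s)).
  exact: is_deriveM.
by move=> ?; apply: is_derive_eq; rewrite /GRing.scale/=; ring.
Qed.

Lemma alternatingZ k c f : 0 <= c ->
  alternating_upto k f -> alternating_upto k (fun s => c * f s).
Proof.
move=> c0 af; apply: alternatingM => //.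
elim: k {af} => [//|k IH] in c c0 *.
split => //; exists (fun=> 0); last exact: IH.
by move=> s s0; rewrite oppr0; exact: is_derive_cst.
Qed.

Lemma alternating_shift k h f : 0 <= h ->
  alternating_upto k f -> alternating_upto k (fun s => f (s + h)).
Proof.
move=> h0; elim: k f => [|k IH] f [f0 af].
  by split => // s s0; rewrite f0// ltr_wpDr.
split; first by move=> s s0; rewrite f0// ltr_wpDr.
move: af => [g fg ag]; exists (fun s => g (s + h)); last exact: IH.
move=> s s0; have sh0 : 0 < s + h by rewrite ltr_wpDr.
have ? := fg _ sh0.
have ? : is_derive s (1 : R) (fun s : R => s + h) 1.
  by apply: is_derive_eq; rewrite addr0.
by rewrite -[- _]mulr1; exact: (is_derive1_comp (f := f)).
Qed.

Lemma alternating_powR k c a : 0 <= c -> a <= 0 ->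
  alternating_upto k (fun s => c * s `^ a).
Proof.
elim: k c a => [|k IH] c a c0 a0.
  by split => // s s0; rewrite mulr_ge0 ?powR_ge0.
split; first by move=> s s0; rewrite mulr_ge0 ?powR_ge0.
exists (fun s => (c * - a) * s `^ (a - 1)).
  move=> s s0; have ? := is_derive1_powR a s0.
  have : is_derive s 1 (fun s : R => c * s `^ a) (c *: (a * s `^ (a - 1))).
    exact: is_deriveZ.
  by move=> ?; apply: is_derive_eq; rewrite /GRing.scale/=; ring.
by apply: IH; [rewrite mulr_ge0 ?oppr_ge0|rewrite subr_le0 (le_trans a0)].
Qed.

(** The inner derivative a * s `^ (a - 1) is completely monotone because
    a <= 1, so the chain rule reduces order k + 1 to a product at order k. *)
Lemma alternating_comp_powR k a f : 0 < a <= 1 ->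
  alternating_upto k f -> alternating_upto k (fun s => f (s `^ a)).
Proof.
move=> /andP[a0 a1]; elim: k f => [|k IH] f [f0 af].
  by split => // s s0; rewrite f0// powR_gt0.
split; first by move=> s s0; rewrite f0// powR_gt0.
move: af => [g fg ag].
exists (fun s => g (s `^ a) * (a * s `^ (a - 1))).
  move=> s s0; have ? := is_derive1_powR a s0.
  have ? := fg _ (powR_gt0 a s0).
  have : is_derive s (1:R) (f \o (fun s : R => s `^ a))
     (- g (s `^ a) * (a * s `^ (a - 1))) by exact: is_derive1_comp.
  by move=> ?; apply: is_derive_eq; rewrite /GRing.scale/=; ring.
apply: alternatingM; first exact: IH.
by apply: alternating_powR; [exact: ltW|rewrite subr_le0].
Qed.

(** The witnesses of [alternating_upto] are, up to sign, the iterated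
    derivatives. *)
Lemma alternating_derive1n k m f : alternating_upto (k + m) f ->
  exists2 g, alternating_upto m g &
    forall s, 0 < s -> derive1n k f s = (-1) ^+ k * g s.
Proof.
elim: k m => [|k IH] m af.
  by exists f => // s _; rewrite expr0 mul1r derive1n0.
rewrite addSnnS in af; have [g [g0 [g' gg' ag']] fg] := IH _ af.
exists g' => // s s0; rewrite derive1nS derive1E.
rewrite (@near_eq_derive _ _ _ _ (fun x => (-1) ^+ k * g x)); last first.
  near=> x; apply: fg; near: x; exact: lt_nbhsr.
have ? := gg' _ s0.
have : is_derive s 1 (fun s : R => (-1) ^+ k * g s) ((-1) ^+ k *: (- g' s)).
  exact: is_deriveZ.
by move=> ?; rewrite derive_val /GRing.scale/= exprSr; ring.
Unshelve. all: by end_near. Qed.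

Lemma alternatingP f : (forall k, alternating_upto k f) <->
  (forall k s, 0 < s ->
    derivable (derive1n k f) s 1 /\ 0 <= (-1) ^+ k * derive1n k f s).
Proof.
split=> [af k s s0|df k].
  have [|g [g0 [g' gg' _]] fg] := alternating_derive1n k 1 f.
    exact: af.
  split.
    apply: (@near_eq_derivable _ _ _ (fun x => (-1) ^+ k * g x)).
      by near=> x; rewrite fg//; near: x; exact: lt_nbhsr.
    have ? := gg' _ s0.
    have : is_derive s 1 (fun s : R => (-1) ^+ k * g s) ((-1) ^+ k *: (- g' s)).
      exact: is_deriveZ.
    by move=> ?; exact: ex_derive.
  by rewrite fg// mulrA -expr2 sqrr_sign mul1r g0.
suff H m : alternating_upto k (fun s => (-1) ^+ m * derive1n m f s).
  have := H 0%N; congr alternating_upto.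
  by apply/funext => s; rewrite expr0 mul1r derive1n0.
elim: k m => [|k IH] m; first by split=> // s s0; exact: (df m s s0).2.
split; first by move=> s s0; exact: (df m s s0).2.
exists (fun s => (-1) ^+ m.+1 * derive1n m.+1 f s) => // s s0.
have : is_derive s 1 (fun s : R => (-1) ^+ m * derive1n m f s)
    ((-1) ^+ m *: derive1 (derive1n m f) s).
  apply: is_deriveZ; rewrite derive1E; apply/derivableP.
  exact: (df m s s0).1.
by move=> ?; apply: is_derive_eq; rewrite derive1nS /GRing.scale/= exprS; ring.
Unshelve. all: by end_near. Qed.

End alternating_upto.

(** * Completely monotone generators *)

(** Continuity of f is only assumed within B; this is what is available at the
    boundary point 0 of [0, +oo[. *)
Lemma within_continuous_comp_homo {T U V : topologicalType} (A : set T)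
    (B : set U) (p : T -> U) (f : U -> V) :
  (forall x, A x -> B (p x)) ->
  {within A, continuous p} -> {within B, continuous f} ->
  {within A, continuous (f \o p)}.
Proof.
move=> pAB /subspace_continuousP cp /subspace_continuousP cf.
apply/subspace_continuousP => x Ax; apply: (@cvg_comp _ _ _ p f); last first.
  exact: cf (pAB _ Ax).
move=> W BW.
have : nbhs x [set z | A z -> B (p z) -> W (p z)] := cp _ Ax _ BW.
suff : [set z | A z -> B (p z) -> W (p z)] `<=` [set z | A z -> W (p z)].
  exact: filterS.
by move=> z /= BWz Az; exact/BWz/pAB.
Qed.

Section generators.
Context {R : realType}.
Implicit Types (psi : R -> R) (s a b h u : R).

Lemma cm_alternating psi : cm_generator psi -> forall k, alternating_upto k psi.
Proof. by move=> [_ _ _ _ d]; apply/alternatingP. Qed.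

Lemma cm_ge0 psi s : cm_generator psi -> 0 <= s -> 0 <= psi s.
Proof. by move=> [_ b _ _ _] /b /andP[]. Qed.

Lemma cm_nincr psi a b : cm_generator psi -> 0 <= a -> a <= b -> psi b <= psi a.
Proof.
move=> cm; have [cpsi _ _ _ _] := cm.
have [_ [g pg [g0 _]]] := cm_alternating _ cm 1.
apply: ler0_derive1_nincry => // x; rewrite in_itv/= andbT => x0.
  by have ? := pg _ x0; exact: ex_derive.
by have ? := pg _ x0; rewrite derive1E derive_val oppr_le0 g0.
Qed.

(** Between a and b the mean value theorem gives a point where psi' vanishes;
    psi' is nonpositive and nondecreasing, so it vanishes ever after. Then psi
    is constant from that point on, with value its limit 0. *)
Lemma cm_flat psi a b : cm_generator psi -> 0 <= a -> a < b ->
  psi a = psi b -> psi a = 0.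
Proof.
move=> cm a0 ab pab; have [cpsi _ _ lim _] := cm.
have [_ [g pg [g0 [g' gg' [g'0 _]]]]] := cm_alternating _ cm 2.
have wc c d : 0 <= c -> {within `[c, d], continuous psi}.
  by move=> c0; apply: continuous_subspaceW cpsi => x /=; rewrite !in_itv/=;
    move=> /andP[cx _]; rewrite andbT (le_trans c0).
have [c + gc] : exists2 c, c \in `]a, b[%R & psi b - psi a = - g c * (b - a).
  apply: (@MVT _ psi (fun x => - g x)) => //; last exact: wc.
  by move=> x; rewrite in_itv/= => /andP[ax _]; apply: pg (le_lt_trans a0 ax).
rewrite in_itv/= => /andP[ac cb]; have c0 : 0 < c by exact: le_lt_trans ac.
have {}gc : g c = 0.
  apply/eqP; move/eqP: gc; rewrite pab subrr eq_sym mulf_eq0 oppr_eq0.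
  by rewrite subr_eq0 (gt_eqF ab) orbF.
have gs0 s : c <= s -> g s = 0.
  move=> cs; apply/eqP; rewrite eq_le (g0 _ (lt_le_trans c0 cs)) andbT -gc.
  have dg x : c <= x -> is_derive x 1 g (- g' x).
    by move=> cx; apply: gg' (lt_le_trans c0 cx).
  apply: (@ler0_derive1_nincry _ g c) => // [x|x|].
  - rewrite in_itv/= andbT => /ltW/dg ?; exact: ex_derive.
  - rewrite in_itv/= andbT => cx; have ? := dg _ (ltW cx).
    by rewrite derive1E derive_val oppr_le0 g'0// (lt_trans c0).
  - apply: derivable_within_continuous => x.
    by rewrite in_itv/= andbT => /dg ?; exact: ex_derive.
have psic s : c <= s -> psi c <= psi s.
  move=> cs; apply: (@ger0_derive1_ndecry _ psi c) => // [x|x|].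
  - rewrite in_itv/= andbT => cx; have ? := pg _ (lt_trans c0 cx).
    exact: ex_derive.
  - rewrite in_itv/= andbT => cx; have ? := pg _ (lt_trans c0 cx).
    by rewrite derive1E derive_val gs0 ?oppr0// ltW.
  - apply: continuous_subspaceW cpsi => x /=; rewrite !in_itv/= !andbT.
    by move=> cx; exact: le_trans (ltW c0) cx.
have pc0 : psi c <= 0.
  apply: (cvgr_to_ge lim); near=> s; apply: psic; near: s.
  by apply: nbhs_pinfty_ge; rewrite num_real.
apply/eqP; rewrite eq_le cm_ge0// andbT pab (le_trans _ pc0)//.
by apply: cm_nincr => //; exact: ltW.
Unshelve. all: by end_near. Qed.

Lemma cm_decr psi a b : cm_generator psi -> 0 <= a -> a < b ->
  0 < psi a -> psi b < psi a.
Proof.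
move=> cm a0 ab pa; rewrite lt_neqAle cm_nincr// ?ltW// andbT.
by apply/eqP => /esym /(cm_flat _ _ _ cm a0 ab) pa0; rewrite pa0 ltxx in pa.
Qed.

Lemma cm_surj psi u : cm_generator psi -> 0 < u <= 1 ->
  exists2 s, 0 <= s & psi s = u.
Proof.
move=> cm /andP[u0 u1]; have [cpsi _ p0 lim _] := cm.
near (pinfty_nbhs R) => N.
have N0 : 0 <= N by near: N; apply: nbhs_pinfty_ge; rewrite num_real.
have [||c] := @IVT _ psi 0 N u N0.
- apply: continuous_subspaceW cpsi => x /=.
  by rewrite !in_itv/= => /andP[-> _].
- rewrite p0 ge_min le_max u1/= andbT; apply/orP; right; apply/ltW.
  by near: N; exact: (cvgr_lt 0).
- by rewrite in_itv/= => /andP[c0 _] <-; exists c.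
Unshelve. all: by end_near. Qed.

Lemma gen_inv_ge0 psi u : (0 <= gen_inv psi u)%E.
Proof.
rewrite /gen_inv; case: ifPn => // _; apply: le_ereal_inf_tmp.
by move=> _ [s [s0 _] <-]; rewrite lee_fin.
Qed.

Lemma gen_inv0 psi : gen_inv psi 0 = +oo%E.
Proof. by rewrite /gen_inv eqxx. Qed.

Lemma gen_invK psi s : cm_generator psi -> 0 <= s -> 0 < psi s ->
  gen_inv psi (psi s) = s%:E.
Proof.
move=> cm s0 ps0; rewrite /gen_inv gt_eqF//.
suff -> : [set r | 0 <= r /\ psi r = psi s] = [set s].
  by rewrite image_set1 ereal_inf1.
apply/seteqP; split=> [r [r0 prs]|r ->//].
case: (ltgtP r s) => // rs.
  by have := cm_decr _ _ _ cm r0 rs; rewrite prs ltxx => /(_ ps0).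
by have := cm_decr _ _ _ cm s0 rs; rewrite prs ltxx => /(_ ps0).
Qed.

Lemma cm_outer_power psi alpha : cm_generator psi -> 0 < alpha <= 1 ->
  cm_generator (outer_power psi alpha).
Proof.
move=> cm alpha01; have /andP[alpha0 _] := alpha01.
have [cpsi b p0 lim _] := cm; split.
- rewrite (_ : outer_power psi alpha = psi \o (fun s => s `^ alpha))//.
  apply: (@within_continuous_comp_homo R R R _ `[0, +oo[) => // [s|].
    by rewrite /= !in_itv/= !andbT powR_ge0.
  apply/continuous_within_itvcyP; split; last first.
    by rewrite powR0 ?gt_eqF//; exact: powR_cvg0.
  move=> s; rewrite in_itv/= andbT => s0; apply: differentiable_continuous.
  by apply/derivable1_diffP/derivable_powR; rewrite in_itv/= andbT.
- by move=> s s0; apply: b; exact: powR_ge0.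
- by rewrite /outer_power powR0 ?gt_eqF.
- apply: (@cvg_comp _ _ _ (fun s => s `^ alpha) psi _ +oo _ _ lim).
  apply/cvgryPge => A; near=> s.
  have A1 : 0 < Num.max A 1 by rewrite lt_max ltr01 orbT.
  rewrite (@le_trans _ _ (Num.max A 1))// ?le_max ?lexx//.
  rewrite -[leLHS](powRr1 (ltW A1)) -(mulVf (lt0r_neq0 alpha0)) powRrM.
  have sA : Num.max A 1 `^ alpha^-1 <= s.
    by near: s; apply: nbhs_pinfty_ge; rewrite num_real.
  have s0 : 0 <= s := le_trans (powR_ge0 _ _) sA.
  by apply: (ge0_ler_powR (ltW alpha0)); rewrite ?nnegrE ?powR_ge0.
- apply/alternatingP => k; apply: alternating_comp_powR => //.
  exact: cm_alternating.
Unshelve. all: by end_near. Qed.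

Lemma cm_tilted psi h : cm_generator psi -> 0 <= h -> 0 < psi h ->
  cm_generator (tilted_generator psi h).
Proof.
move=> cm h0 ph; have [cpsi b p0 lim _] := cm; split.
- have cs : {within `[0, +oo[, continuous (fun s => psi (s + h))}.
    rewrite (_ : (fun s => psi (s + h)) = psi \o (fun s => s + h))//.
    apply: (@within_continuous_comp_homo R R R _ `[0, +oo[) => // [s|].
      by rewrite /= !in_itv/= !andbT => s0; rewrite addr_ge0.
    by apply: continuous_subspaceT => s; apply: cvgD => //; exact: cvg_cst.
  by move=> s; apply: cvgMl; exact: cs.
- move=> s s0; have sh0 : 0 <= s + h by rewrite addr_ge0.
  rewrite /tilted_generator divr_ge0 ?(ltW ph)//=; last exact: (cm_ge0 psi).
  by rewrite ler_pdivrMr// mul1r cm_nincr// lerDr.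
- by rewrite /tilted_generator add0r divff// gt_eqF.
- rewrite -[X in _ --> X](mul0r (psi h)^-1); apply: cvgMl.
  apply: (@cvg_comp _ _ _ (fun s => s + h) psi _ +oo _ _ lim).
  apply/cvgryPge => A; near=> s; rewrite -lerBlDr; near: s.
  by apply: nbhs_pinfty_ge; rewrite num_real.
- apply/alternatingP => k.
  have := alternatingZ _ (psi h)^-1 _ _
    (alternating_shift _ _ _ h0 (cm_alternating _ cm k)).
  rewrite invr_ge0 ltW// => /(_ isT); congr alternating_upto.
  by apply/funext => s; rewrite mulrC.
Unshelve. all: by end_near. Qed.

End generators.

(** * Uniform laws and the probability integral transform *)

Section uniform.
Context {R : realType}.
Implicit Types (P Q : probability (measurableTypeR R) R).

(** The rays ]x, +oo[ generate the Borel sets and are closed under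
    intersection. *)
Lemma eq_probability_cdf P Q :
  (forall x : R, P `]-oo, x]%classic = Q `]-oo, x]%classic) ->
  forall A, measurable A -> P A = Q A.
Proof.
move=> PQ; apply: (@measure_unique _ R (measurableTypeR R)
  (@measurable_realfun.RGenOInfty.G R) (fun n => `]- n%:R, +oo[%classic)).
- exact: measurable_realfun.RGenOInfty.measurableE.
- move=> _ _ [x ->] [y ->]; exists (Num.max x y); apply/seteqP; split=> z /=;
    by rewrite !in_itv/= !andbT gt_max => /andP.
- by move=> n; eexists; reflexivity.
- apply/seteqP; split=> // x _; exists (Num.truncn `|x|).+1 => //=.
  rewrite in_itv/= andbT ltrNl (le_lt_trans _ (truncnS_gt _))// -normrN.
  exact: ler_norm.
- move=> _ [x ->]; rewrite -setCitvl.
  have mx : measurable (`]-oo, x]%classic : set (measurableTypeR R)) by [].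
  apply: etrans (probability_setC P mx) _; rewrite PQ.
  exact/esym/(probability_setC Q mx).
- by move=> n; rewrite (le_lt_trans (probability_le1 _ _))// ltry.
Qed.

Lemma uniform_prob_cdf (v : R) : 0 <= v <= 1 ->
  uniform_prob (@ltr01 R) `]-oo, v]%classic = v%:E.
Proof.
move=> /andP[v0 v1]; rewrite /uniform_prob integral_uniform_pdf.
rewrite (_ : _ `&` _ = `[0, v]%classic); last first.
  apply/seteqP; split=> z /=; rewrite !in_itv/=.
    by move=> [zv /andP[-> _]].
  by move=> /andP[z0 zv]; rewrite z0 (le_trans zv v1).
rewrite (eq_integral (fun=> 1%E)); last first.
  move=> x; rewrite inE/= in_itv/= /uniform_pdf => /andP[x0 xv].
  by rewrite x0 (le_trans xv v1) subr0 invr1.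
rewrite integral_cst//= mul1e lebesgue_measure_itv/= lte_fin.
by case: ltgtP v0 => // [_ _|<- _]; rewrite ?sube0.
Qed.

Lemma uniform_prob_unique P :
  (forall v : R, 0 <= v <= 1 -> P `]-oo, v]%classic = v%:E) ->
  forall A, measurable A -> P A = uniform_prob (@ltr01 R) A.
Proof.
move=> Pv; apply: eq_probability_cdf => x.
have [x0|x0] := ltP x 0.
  suff H (Q : probability (measurableTypeR R) R) :
      Q `]-oo, 0]%classic = 0%E -> Q `]-oo, x]%classic = 0%E.
    have i0 : 0 <= (0 : R) <= 1 by rewrite lexx ler01.
    by rewrite !H//; [exact: (uniform_prob_cdf 0 i0)|exact: Pv].
  move=> Q0; apply/eqP; rewrite -measure_le0 -Q0 le_measure ?inE//.
  by move=> z /=; rewrite !in_itv/= => zx; rewrite (le_trans zx)// ltW.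
have [x1|x1] := leP x 1.
  have x01 : 0 <= x <= 1 by rewrite x0.
  by rewrite Pv//; exact/esym/(uniform_prob_cdf x x01).
suff H (Q : probability (measurableTypeR R) R) :
    Q `]-oo, 1]%classic = 1%E -> Q `]-oo, x]%classic = 1%E.
  have i1 : 0 <= (1 : R) <= 1 by rewrite lexx ler01.
  by rewrite !H//; [exact: (uniform_prob_cdf 1 i1)|exact: Pv].
move=> Q0; apply/eqP; rewrite eq_le probability_le1//= -Q0 le_measure ?inE//.
by move=> z /=; rewrite !in_itv/= => zx; rewrite (le_trans zx)// ltW.
Qed.

End uniform.

Section uniform_on_reals.
Context {R : realType}.

(** The real line carries two measurable structures with the same measurable
    sets; the identity transports probabilities from one to the other. *)
Let to_ocitv : R -> measurableTypeR R := idfun.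

Let measurable_to_ocitv : measurable_fun setT to_ocitv.
Proof. by move=> _ A mA; rewrite setTI. Qed.

#[local] HB.instance Definition _ :=
  isMeasurableFun.Build _ _ _ _ to_ocitv measurable_to_ocitv.

Lemma uniform_probP (P : probability R R) :
  (forall v : R, 0 <= v <= 1 -> P `]-oo, v]%classic = v%:E) ->
  forall A, measurable A -> P A = uniform_prob (@ltr01 R) A.
Proof. exact: (uniform_prob_unique (distribution P to_ocitv)). Qed.

End uniform_on_reals.

Section integral_transform.
Context {disp : measure_display} {T : measurableType disp} {R : realType}.
Variables (P : probability T R) (X : {RV P >-> R}).

Definition cdf_transform (w : T) : R := fine (cdf X (X w)).

Lemma fine_cdf_itv (x : R) : 0 <= fine (cdf X x) <= 1.
Proof.
by rewrite fine_ge0//= -lee_fin fineK ?fin_num_measure// cdf_le1.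
Qed.

Lemma fine_cdf_nd (x y : R) : x <= y -> fine (cdf X x) <= fine (cdf X y).
Proof. by move=> xy; rewrite fine_le ?fin_num_measure// cdf_nondecreasing. Qed.

Lemma measurable_cdf_transform : measurable_fun setT cdf_transform.
Proof.
apply: (measurableT_comp (f := fun x => fine (cdf X x))) => //.
apply: measurable_realfun.nondecreasing_measurable => // x y.
exact: fine_cdf_nd.
Qed.

HB.instance Definition _ :=
  isMeasurableFun.Build _ _ _ _ cdf_transform measurable_cdf_transform.

Hypothesis cdf_onto : forall v : R, 0 <= v <= 1 -> exists x, fine (cdf X x) = v.

(** Write v = F x. The event F X <= v contains X <= x, which has probability
    v. For w in ]v, 1] with w = F y, it is contained in X <= y, whose
    probability is w. *)
Lemma cdf_transform_uniform (v : R) : 0 <= v <= 1 ->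
  P (cdf_transform @^-1` `]-oo, v]) = v%:E.
Proof.
move=> /andP[v0 v1].
have cdfE x : P (X @^-1` `]-oo, x]) = (fine (cdf X x))%:E.
  by rewrite fineK ?fin_num_measure.
apply/eqP; rewrite eq_le; apply/andP; split; last first.
  have [|x xv] := cdf_onto v; first by rewrite v0.
  rewrite -xv -cdfE le_measure ?inE//; [exact: measurable_funPTI..|].
  by move=> w /=; rewrite !in_itv/= => /fine_cdf_nd.
apply/lee_addgt0Pr => e e0.
have [e1|e1] := leP (v + e) 1; last first.
  by rewrite (le_trans (probability_le1 _ _))//; [exact: measurable_funPTI|
    rewrite -EFinD lee_fin ltW].
have [|x xv] := cdf_onto (v + e); first by rewrite e1 addr_ge0// ltW.
rewrite -EFinD -xv -cdfE le_measure ?inE//; [exact: measurable_funPTI..|].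
move=> w /=; rewrite !in_itv/= => wv; rewrite leNgt; apply/negP => /ltW.
by move=> /fine_cdf_nd; rewrite xv => /le_trans/(_ wv); rewrite leNgt ltrDl e0.
Qed.

End integral_transform.

(** * Sklar's theorem when every margin is onto *)

Section sklar.
Context {disp : measure_display} {T : measurableType disp} {R : realType}.
Variables (d : nat) (P : probability T R) (X : 'I_d -> {RV P >-> R}).
Implicit Types (K : ('I_d -> R) -> R) (x u : 'I_d -> R).

Let F j (x : R) := fine (cdf (X j) x).

Lemma joint_cdf_le_cdf x j : (joint_cdf X x <= cdf (X j) (x j))%E.
Proof.
rewrite le_measure ?inE//.
- exact: measurable_le_event.
- exact: measurable_funPTI.
- by move=> w /(_ j I).
Qed.

Hypothesis cdf_onto : forall j (v : R), 0 <= v <= 1 -> exists y, F j y = v.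

(** The witnesses are the transforms F_j (X_j). For u_j = F_j (x_j) the event
    F_j (X_j) <= u_j contains X_j <= x_j and has the same probability u_j, so
    the two differ by a null set; hence so do the intersections over j. *)
Lemma is_copula_of_joint_cdf K :
  (forall x, joint_cdf X x = (K (fun j => F j (x j)))%:E) -> is_copula K.
Proof.
move=> XK; pose V j : {RV P >-> R} := cdf_transform P (X j).
exists disp, T, P, V; split=> [j A mA|u u01].
  apply: (uniform_probP (distribution P (V j))) => // v v01.
  by apply: cdf_transform_uniform v01; exact: cdf_onto.
have /choice[x xu] : forall j, exists y, F j y = u j.
  by move=> j; apply: cdf_onto; exact: u01.
have -> : u = (fun j => F j (x j)) by apply/funext => j; rewrite xu.
rewrite -XK /joint_cdf.
set E := le_event V _; set E' := le_event X x.
have mE : measurable E by exact: measurable_le_event.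
have mE' : measurable E' by exact: measurable_le_event.
have E'E : E' `<=` E.
  move=> w E'w j _; move: (E'w j I); rewrite /= !in_itv/=.
  exact: fine_cdf_nd.
pose N j := V j @^-1` `]-oo, F j (x j)] `\` X j @^-1` `]-oo, x j].
have mV j : measurable (V j @^-1` `]-oo, F j (x j)]).
  exact: measurable_funPTI.
have mX j : measurable (X j @^-1` `]-oo, x j]) by exact: measurable_funPTI.
have N0 j : P.-negligible (N j).
  exists (N j); split => //; first exact: measurableD.
  rewrite measureD//; last first.
    by rewrite (le_lt_trans (probability_le1 _ _))// ltry.
  rewrite setIidr; last first.
    by move=> w /=; rewrite !in_itv/=; exact: fine_cdf_nd.
  have PV : P (V j @^-1` `]-oo, F j (x j)]) = (F j (x j))%:E.
    by apply: cdf_transform_uniform; [exact: cdf_onto|exact: fine_cdf_itv].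
  have PX : P (X j @^-1` `]-oo, x j]) = (F j (x j))%:E.
    by rewrite fineK ?fin_num_measure.
  suff : (P (V j @^-1` `]-oo, F j (x j)]) -
    P (X j @^-1` `]-oo, x j]) = 0)%E by [].
  by rewrite PV PX subee.
have EN : E `\` E' `<=` \big[setU/set0]_(j < d) N j.
  move=> w [Ew nE'w]; suff [j Njw] : exists j, N j w.
    by rewrite (bigD1 j)//=; left.
  apply: contrapT => nN; apply: nE'w => j _.
  apply: contrapT => nX; apply: nN; exists j.
  by split => //; exact: Ew.
have : P.-negligible (E `\` E').
  apply: negligibleS EN _; elim/big_ind : _ => //; first exact: negligible_set0.
  exact: negligibleU.
move/(negligibleP _ (measurableD mE mE')) => ED0.
by rewrite (measureDI P mE mE') ED0 add0e setIidr.
Qed.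

(** Since x |-> (F_j (x_j))_j covers the unit cube, the Sklar identity
    leaves no freedom for the values of a copula there. *)
Lemma sklar_continuous K :
  (forall x, joint_cdf X x = (K (fun j => F j (x j)))%:E) ->
  forall K', is_copula_of X K' <-> (forall u, unit_cube u -> K' u = K u).
Proof.
move=> XK K'; split=> [[_ XK'] u u01|K'K].
  have /choice[x xu] : forall j, exists y, F j y = u j.
    by move=> j; apply: cdf_onto; exact: u01.
  have -> : u = (fun j => F j (x j)) by apply/funext => j; rewrite xu.
  by apply: EFin_inj; rewrite -XK -XK'.
have XK' x : joint_cdf X x = (K' (fun j => F j (x j)))%:E.
  by rewrite XK K'K// => j; exact: fine_cdf_itv.
by split => //; exact: is_copula_of_joint_cdf.
Qed.

End sklar.

(** * Archimedean copulas and tilting *)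

Section archimedean.
Context {R : realType} {d : nat}.
Implicit Types (psi : R -> R) (u y t : 'I_d -> R).

Definition replace u (j : 'I_d) (x : R) : 'I_d -> R :=
  fun k => if k == j then x else u k.

Lemma archimedean_psi psi (a : 'I_d -> R) : cm_generator psi ->
  (forall j, 0 <= a j) -> (forall j, 0 < psi (a j)) ->
  archimedean psi (fun j => psi (a j)) = psi (\sum_(j < d) a j).
Proof.
move=> cm a0 pa; rewrite /archimedean (eq_bigr (fun j => (a j)%:E)).
  by rewrite sumEFin.
by move=> j _; rewrite gen_invK.
Qed.

Lemma archimedean_eq0 psi u j : u j = 0 -> archimedean psi u = 0.
Proof.
move=> uj0; rewrite /archimedean (bigD1 j)//= uj0 gen_inv0 addye//.
rewrite gt_eqF// (lt_le_trans ltNy0)// sume_ge0// => k _.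
exact: gen_inv_ge0.
Qed.

Lemma sum_replace (a : 'I_d -> R) j (x : R) :
  \sum_(k < d) replace a j x k = \sum_(k < d) a k + (x - a j).
Proof.
rewrite (bigD1 j)//= [in RHS](bigD1 j)//= /replace eqxx.
under eq_bigr => k kj do rewrite (negbTE kj).
ring.
Qed.

Lemma archimedean_replace psi (b : 'I_d -> R) j (x : R) : cm_generator psi ->
  (forall k, 0 <= b k) -> (forall k, 0 < psi (b k)) -> 0 <= x -> 0 < psi x ->
  archimedean psi (replace (fun k => psi (b k)) j (psi x)) =
  psi (\sum_(k < d) b k + (x - b j)).
Proof.
move=> cm b0 pb x0 px; rewrite -sum_replace -archimedean_psi//.
- by congr archimedean; apply/funext => k; rewrite /replace; case: ifP.
- by move=> k; rewrite /replace; case: ifP.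
- by move=> k; rewrite /replace; case: ifP.
Qed.

(** With y_j = psi a_j, the j-th argument on the left is the tilted generator
    at a_j - b_j, and the sum of these differences is (sum_j a_j) - h. *)
Lemma archimedean_tilted psi (b : 'I_d -> R) y : cm_generator psi ->
  let t := fun k => psi (b k) in
  let h := \sum_(k < d) b k in
  (forall k, 0 <= b k) -> (forall k, 0 < t k) -> 0 < psi h ->
  (forall j, 0 <= y j <= t j) ->
  (forall j, 0 < archimedean psi (replace t j (y j))) ->
  archimedean (tilted_generator psi h)
    (fun j => archimedean psi (replace t j (y j)) / psi h) =
  archimedean psi y / psi h.
Proof.
move=> cm t h b0 tb ph yt G0.
have h0 : 0 <= h by apply: sumr_ge0.
have y0 j : 0 < y j.
  rewrite lt_def; have /andP[-> _] := yt j; rewrite andbT.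
  apply: contraTneq (G0 j) => yj0.
  by rewrite (archimedean_eq0 _ _ j) ?ltxx// /replace eqxx.
have [_ _ psi1 _ _] := cm.
have /choice[a aP] : forall j, exists a, 0 <= a /\ psi a = y j.
  move=> j; have [|a a0 ay] := cm_surj _ (y j) cm; last by exists a.
  rewrite y0/=; have /andP[_ /le_trans] := yt j; apply.
  by rewrite -psi1 cm_nincr.
have a0 j : 0 <= a j by have [] := aP j.
have ya : y = (fun j => psi (a j)) by apply/funext => j; have [] := aP j.
have pa j : 0 < psi (a j) by have [_ ->] := aP j.
have ba j : b j <= a j.
  rewrite leNgt; apply/negP => ab; have := cm_decr _ _ _ cm (a0 j) ab (pa j).
  by have /andP[_] := yt j; rewrite ya /t leNgt => /negP.
have cmt := cm_tilted _ _ cm h0 ph.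
have GE j : archimedean psi (replace t j (y j)) / psi h =
    tilted_generator psi h (a j - b j).
  by rewrite ya archimedean_replace// /tilted_generator addrC.
under [in LHS]eq_fun => j do rewrite GE.
rewrite archimedean_psi//.
- by rewrite sumrB -/h /tilted_generator subrK ya archimedean_psi.
- by move=> j; rewrite subr_ge0.
- by move=> j; rewrite -GE divr_gt0.
Qed.

End archimedean.

(** * The law of U given U <= t *)

Section truncated_law.
Context {disp : measure_display} {T : measurableType disp} {R : realType}.
Variables (d : nat) (P : probability T R) (U : 'I_d -> {RV P >-> R}).
Implicit Types (x t y u : 'I_d -> R).

Lemma le_eventI x t : le_event U x `&` le_event U t =
  le_event U (fun j => Num.min (x j) (t j)).
Proof.
apply/seteqP; split=> [w [wx wt] j _|w wm].
  by move: (wx j I) (wt j I) => /=; rewrite !in_itv/= le_min => -> ->.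
by split=> j _; move: (wm j I) => /=; rewrite !in_itv/= le_min => /andP[].
Qed.

Lemma preimage_leI t j (x : R) : U j @^-1` `]-oo, x] `&` le_event U t =
  le_event U (replace t j (Num.min x (t j))).
Proof.
apply/seteqP; split=> [w [wx wt] k _|w wm].
  rewrite /replace; case: eqP => [->|_]; last exact: wt.
  by move: wx (wt j I) => /=; rewrite !in_itv/= le_min => -> ->.
split=> [|k _].
  by move: (wm j I) => /=; rewrite /replace eqxx !in_itv/= le_min => /andP[].
move: (wm k I) => /=; rewrite /replace; case: eqP => // ->.
by rewrite !in_itv/= le_min => /andP[].
Qed.

Variables (C : ('I_d -> R) -> R) (t : 'I_d -> R).
Hypotheses (UC : copula_law U C) (t01 : forall j, 0 <= t j <= 1) (Ct : 0 < C t).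

Let Q : probability T R := cond_prob P (measurable_le_event U t).

Let F j (x : R) : R := fine (cdf (P := Q) (U j) x).

Lemma cond_probE B : Q B = (P (B `&` le_event U t) * ((C t)^-1)%:E)%E.
Proof.
have PA : P (le_event U t) = (C t)%:E by exact: UC.2.
rewrite /Q /cond_prob /= /mnormalize /= /mrestr setTI PA.
by rewrite eqe gt_eqF.
Qed.

Lemma cond_joint_cdf x : (forall j, 0 <= x j) ->
  joint_cdf (P := Q) U x =
  (C (fun j => Num.min (x j) (t j)) / C t)%:E.
Proof.
move=> x0; rewrite /joint_cdf cond_probE le_eventI.
have -> : P (le_event U (fun j => Num.min (x j) (t j))) =
    (C (fun j => Num.min (x j) (t j)))%:E.
  apply: UC.2 => j; have /andP[t0 t1] := t01 j.
  by rewrite le_min ge_min x0 t0 t1 orbT.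
by rewrite EFinM.
Qed.

Lemma cond_cdf j (x : R) : 0 <= x ->
  F j x = C (replace t j (Num.min x (t j))) / C t.
Proof.
move=> x0; rewrite /F /cdf /distribution /pushforward cond_probE preimage_leI.
have -> : P (le_event U (replace t j (Num.min x (t j)))) =
    (C (replace t j (Num.min x (t j))))%:E.
  apply: UC.2 => k; rewrite /replace; case: eqP => _ //.
  have /andP[t0 t1] := t01 j.
  by rewrite le_min ge_min x0 t0 t1 orbT.
by [].
Qed.

Lemma cond_cdf_lt0 j (x : R) : x < 0 -> F j x = 0.
Proof.
move=> x0; rewrite /F /cdf /distribution /pushforward cond_probE.
suff -> : P (U j @^-1` `]-oo, x] `&` le_event U t) = 0%E by rewrite mul0e.
apply/eqP; rewrite -measure_le0.
have U0 : P (U j @^-1` `]-oo, 0]) = 0%E.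
  apply: etrans (UC.1 j `]-oo, 0]%classic _) (uniform_prob_cdf 0 _) => //.
  by rewrite lexx ler01.
rewrite -U0 le_measure ?inE//.
- by apply: measurableI; [exact: measurable_funPTI|exact: measurable_le_event].
- exact: measurable_funPTI.
- move=> w [] /=; rewrite !in_itv/= => wx _.
  by rewrite (le_trans wx)// ltW.
Qed.

End truncated_law.

(** At x >= 0 the conditional joint distribution function is
    C(min(x, t)) / C(t). If some F_j (x_j) = 0, it vanishes at x,
    and so does the Archimedean copula, one of whose arguments has an infinite
    inverse.
    Otherwise x >= 0 and [archimedean_tilted] applies to y = min(x, t). *)
Lemma right_truncated_archimedean {disp : measure_display}
    {T : measurableType disp} {R : realType} {d : nat} (P : probability T R)
    (U : 'I_d -> {RV P >-> R}) (psi : R -> R) (t : 'I_d -> R) (h : R) :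
  cm_generator psi -> copula_law U (archimedean psi) ->
  (forall j, 0 < t j <= 1) -> 0 < archimedean psi t ->
  0 <= h -> psi h = archimedean psi t ->
  forall K, right_truncated_copula U t K <->
    (forall u, unit_cube u -> K u = archimedean (tilted_generator psi h) u).
Proof.
move=> cm UC t01 Ct0 h0 ph.
have ph0 : 0 < psi h by rewrite ph.
have cmt := cm_tilted _ _ cm h0 ph0.
have t01' j : 0 <= t j <= 1 by have /andP[/ltW -> ->] := t01 j.
have /choice[b bP] : forall j, exists b, 0 <= b /\ psi b = t j.
  by move=> j; have [b b0 bt] := cm_surj _ _ cm (t01 j); exists b.
have b0 j : 0 <= b j by have [] := bP j.
have tb : t = (fun j => psi (b j)) by apply/funext => j; have [] := bP j.
have pb j : 0 < psi (b j) by have [_ ->] := bP j; have /andP[] := t01 j.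
have hb : h = \sum_(k < d) b k.
  apply: EFin_inj; rewrite -(gen_invK psi)// ph -(gen_invK psi) ?sumr_ge0//.
    by rewrite tb archimedean_psi.
  by rewrite -archimedean_psi// -tb.
have cdf0 := cond_cdf_lt0 _ _ _ _ _ UC t01' Ct0.
have cdfE := cond_cdf _ _ _ _ _ UC t01' Ct0.
have jointE := cond_joint_cdf _ _ _ _ _ UC t01' Ct0.
apply: sklar_continuous => [j v /andP[v0 v1]|x].
  move: v0; rewrite le_eqVlt => /predU1P[<-|v0].
    by exists (-1); apply: cdf0; rewrite ltrN10.
  have [|s s0 psis] := cm_surj _ v cmt; first by rewrite v0.
  have psh : psi (s + h) = v * psi h.
    by rewrite -psis /tilted_generator divfK// gt_eqF.
  have bjh : b j <= h by rewrite hb (bigD1 j)//= lerDl sumr_ge0.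
  have sb0 : 0 <= s + b j by rewrite addr_ge0.
  have px : 0 < psi (s + b j).
    rewrite (lt_le_trans (y := psi (s + h))) ?psh ?mulr_gt0//.
    by rewrite -psh cm_nincr// lerD2l.
  (* at psi (s + b j) the j-th margin is psi (s + h) / psi h, which is v *)
  exists (psi (s + b j)); rewrite cdfE ?(ltW px)//.
  have /min_idPl -> : psi (s + b j) <= t j.
    by rewrite tb cm_nincr// lerDr.
  rewrite {1}tb archimedean_replace// -hb -ph addrK [h + s]addrC psh mulfK//.
  by rewrite gt_eqF.
pose F j := fine (cdf (P := cond_prob P (measurable_le_event U t)) (U j) (x j)).
have [[j Fj0]|nF] := pselect (exists j, F j = 0).
  rewrite (archimedean_eq0 _ _ _ Fj0); apply/eqP; rewrite -measure_le0.
  by rewrite (le_trans (joint_cdf_le_cdf _ _ _ _ j))// -[leLHS]fineK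
    ?fin_num_measure// -/(F j) Fj0.
have x0 j : 0 <= x j.
  by rewrite leNgt; apply/negP => xj; apply: nF; exists j; exact: cdf0.
have FE j : F j = archimedean psi (replace t j (Num.min (x j) (t j))) / psi h.
  by rewrite ph -cdfE.
have F0 j : 0 < F j.
  rewrite lt_def; have /andP[F0 _] :=
    fine_cdf_itv (cond_prob P (measurable_le_event U t)) (U j) (x j).
  rewrite F0 andbT.
  by apply/eqP => Fj0; apply: nF; exists j.
rewrite jointE//; congr EFin; apply/esym; rewrite -ph.
have -> : (fun j => F j) =
    (fun j => archimedean psi (replace t j (Num.min (x j) (t j))) / psi h).
  exact/funext.
rewrite hb tb; apply: archimedean_tilted => //.
- by rewrite -hb.
- move=> j; rewrite -[psi (b j)]/((fun j => psi (b j)) j) -tb ge_min lexx orbT.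
  by rewrite le_min x0/= andbT; have /andP[] := t01' j.
- move=> j; have := F0 j; rewrite FE pmulr_lgt0 ?invr_gt0// => Gj.
  by rewrite -[psi (b j)]/((fun j => psi (b j)) j) -tb.
Qed.

Theorem mainTheorem3 (R : realType) (d : nat) (psi : R -> R) (alpha : R)
    (t : 'I_d -> R)
    (hpsi : cm_generator psi) (halpha : 0 < alpha <= 1)
    (ht : forall j, 0 < t j <= 1) :
  let psio := outer_power psi alpha in
  let Co := @archimedean R d psio in
  0 < Co t ->
  let psit := fun s : R => gen_ext psio (s%:E + gen_inv psio (Co t))%E / Co t in
  forall (disp : measure_display) (T : measurableType disp)
    (P : probability T R) (U : 'I_d -> {RV P >-> R}),
  copula_law U Co ->
  [/\ cm_generator psit,
      exists2 h : R, 0 <= h &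
        forall s, 0 <= s -> psit s = tilted_generator psio h s &
      forall K : ('I_d -> R) -> R,
        right_truncated_copula U t K <->
        (forall u, unit_cube u -> K u = archimedean psit u)].
Proof.
move=> psio Co Ct0 psit disp T P U UC.
have cm : cm_generator psio by exact: cm_outer_power.
(* h is the argument of psio in the definition of Co t, finite as Co t > 0 *)
have [h h0 psih] : exists2 h, 0 <= h & psio h = Co t.
  move: Ct0; rewrite /Co /archimedean.
  have : (0 <= \sum_(j < d) gen_inv psio (t j))%E.
    by apply: sume_ge0 => j _; exact: gen_inv_ge0.
  case: (\sum_(j < d) _)%E => [h|//|//]/=; last by rewrite ltxx.
  by rewrite lee_fin => h0 _; exists h.
have psi0 : 0 < psio h by rewrite psih.
have -> : psit = tilted_generator psio h.
  by apply/funext => s; rewrite /psit -psih gen_invK.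
split; [exact: cm_tilted|by exists h|].
exact: right_truncated_archimedean.
Qed.
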